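(* There exists a graphon $W$ on $[0,1]$ such that there is no graphon $W_1$ on $[0,1]$ that is equivalent to $W$ and whose degree function $D_{W_1}(x)=\int_0^1 W_1(x,y)\,dy$ is (weakly) increasing, i.e. satisfies $D_{W_1}(x)\le D_{W_1}(y)$ whenever $x\le y$.
   Context: A graphon on a probability space $(\Omega,\mathcal{F},\mu)$ is a symmetric measurable function $W:\Omega\times\Omega\to[0,1]$; here $[0,1]$ carries Lebesgue measure. Two graphons are equivalent if they define the same graph limit, i.e. they have the same homomorphism densities $t(F,W)=\int \prod_{ij\in E(F)} W(x_i,x_j)\,d\mu(x_1)\cdots d\mu(x_{|F|})$ for every finite simple graph $F$. The degree function of a graphon $W$ on $[0,1]$ is $D_W(x)=\int_0^1 W(x,y)\,dy$. ''Increasing'' is meant in the weak sense: $f(x)\le f(y)$ whenever $x\le y$. *)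

(* Defs.v *)
From mathcomp Require Import all_boot all_order all_algebra.
From mathcomp Require Import all_classical all_reals all_analysis.

Set Implicit Arguments.
Unset Strict Implicit.
Unset Printing Implicit Defensive.

Import Order.TTheory GRing.Theory Num.Theory.
Import numFieldNormedType.Exports.

Local Open Scope classical_set_scope.
Local Open Scope ring_scope.

Section graphon.
Context {R : realType}.

Local Notation mu := (@lebesgue_measure R).
Local Notation I01 := (`[0%R, 1%R]%classic : set (measurableTypeR R)).

(* A graphon on [0,1] is represented by a function on R x R of which only the
   values on the unit square matter: every condition, integral and order
   comparison below is restricted to [0,1]. Measurability is with respect to
   the product of the Borel sigma-algebras. *)
Definition is_graphon (W : R -> R -> R) : Prop :=
  [/\ measurable_fun (I01 `*` I01) (fun p => W p.1 p.2 : measurableTypeR R),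
      forall x y : R, I01 x -> I01 y -> W x y = W y x &
      forall x y : R, I01 x -> I01 y -> 0 <= W x y <= 1].

(* The iterated integral of f(x_1, ..., x_n) dx_1 ... dx_n over [0,1]^n. *)
Fixpoint integral01 (n : nat) : (n.-tuple R -> \bar R) -> \bar R :=
  match n with
  | 0%N => fun f => f [tuple]
  | m.+1 => fun f =>
      (\int[mu]_(x in I01) integral01 (fun t : m.-tuple R => f [tuple of x :: t]))%E
  end.

(* The finite simple graph F has vertex set 'I_n and adjacency relation e;
   each edge ij is counted once, as the pair with i < j. *)
Definition hom_density (n : nat) (e : rel 'I_n) (W : R -> R -> R) : \bar R :=
  integral01 (fun x : n.-tuple R =>
    (\prod_(p : 'I_n * 'I_n | (p.1 < p.2)%N && e p.1 p.2)
       W (tnth x p.1) (tnth x p.2))%:E).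

Definition graphon_equiv (W W' : R -> R -> R) : Prop :=
  forall (n : nat) (e : rel 'I_n), symmetric e -> irreflexive e ->
    hom_density e W = hom_density e W'.

Definition degree (W : R -> R -> R) (x : R) : \bar R :=
  (\int[mu]_(y in I01) (W x y)%:E)%E.

Definition increasing_degree (W : R -> R -> R) : Prop :=
  forall x y : R, I01 x -> I01 y -> x <= y -> (degree W x <= degree W y)%E.

End graphon.

(* Main.v *)
(** Equivalent graphons have the same joint moments of the degree [D(x)] and the
    second-order degree [g(x) = \int W(x,y) D(y) dy], since the mean of [g^a D^b]
    is the density of a spider (a tree with [a] legs of length two and [b] legs
    of length one).  With [t(x) = 2x - 1] and [r(x) = t(x)^2 - 1/3], the graphon
    [W = 1/2 + (r(x) + r(y) + t(x) r(y) + t(y) r(x)) / 8] has [D = 1/2 + r/8] and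
    [g = D/2 + (1 + t)/720].  Hence [D] takes every value at most twice, and the
    deviation [h = g - D/2 - 1/720 = t/720] is nonzero but orthogonal to all
    polynomials in [D], by the symmetry [x -> 1 - x].  If an equivalent graphon had
    an increasing degree function [D1], then [D1] would be strictly increasing
    because its law has no atoms.  So the polynomials in [D1] would approximate the
    indicators of all intervals [[0, s]], and the corresponding deviation [h1]
    would vanish almost everywhere, although [h1] and [h] have the same second
    moment. *)

Require Import Defs.
From mathcomp Require Import all_boot all_order all_algebra.
From mathcomp Require Import all_classical all_reals all_analysis.
From mathcomp Require Import measurable_realfun ring lra.

Set Implicit Arguments.
Unset Strict Implicit.
Unset Printing Implicit Defensive.

Import Order.TTheory GRing.Theory Num.Theory.
Import numFieldNormedType.Exports.

Local Open Scope classical_set_scope.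
Local Open Scope ring_scope.

(** * Bounded measurable functions on the unit interval and their means *)

Section bounded_measurable.
Context {R : realType}.

Local Notation mu := (@lebesgue_measure R).
Local Notation I01 := (`[0%R, 1%R]%classic : set (measurableTypeR R)).

(** This class is closed under ring operations and consists of integrable functions, so real-valued
    means can be computed linearly with light side conditions. *)
Definition bounded_measurable01 (f : R -> R) : Prop :=
  measurable_fun I01 (f : measurableTypeR R -> measurableTypeR R) /\
  exists M : R, forall x, I01 x -> `|f x| <= M.

Local Notation bm := bounded_measurable01.

Definition mean01 (f : R -> R) : R := \int[mu]_(x in I01) f x.

Lemma measurable_I01 : measurable I01.
Proof. exact: measurable_itv. Qed.
Hint Resolve measurable_I01 : core.

Lemma lebesgue_I01 : mu I01 = 1%:E.
Proof. by rewrite lebesgue_measure_itv /= lte_fin ltr01 -EFinB subr0. Qed.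

Lemma bm_cst c : bm (fun=> c).
Proof. by split; [exact: measurable_cst | exists `|c|]. Qed.

Lemma bmD f g : bm f -> bm g -> bm (fun x => f x + g x).
Proof.
move=> [mf [M fM]] [mg [N gN]]; split; first exact: measurable_funD.
by exists (M + N) => x Ix; rewrite (le_trans (ler_normD _ _))// lerD ?fM ?gN.
Qed.

Lemma bmM f g : bm f -> bm g -> bm (fun x => f x * g x).
Proof.
move=> [mf [M fM]] [mg [N gN]]; split; first exact: measurable_funM.
by exists (M * N) => x Ix; rewrite normrM ler_pM ?fM ?gN.
Qed.

Lemma bmN f : bm f -> bm (fun x => - f x).
Proof.
move=> bf; rewrite (_ : (fun x => _) = (fun x => -1 * f x)); last first.
  by apply/funext => x; rewrite mulN1r.
by apply: bmM => //; exact: bm_cst.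
Qed.

Lemma bmB f g : bm f -> bm g -> bm (fun x => f x - g x).
Proof. by move=> bf bg; apply: bmD => //; exact: bmN. Qed.

Lemma bmX f n : bm f -> bm (fun x => f x ^+ n).
Proof.
move=> bf; elim: n => [|n IH]; first exact: bm_cst.
rewrite (_ : (fun x => _) = (fun x => f x * f x ^+ n)); first exact: bmM.
by apply/funext => x; rewrite exprS.
Qed.

Lemma bm_sum (I : Type) (s : seq I) (F : I -> R -> R) :
  (forall i, bm (F i)) -> bm (fun x => \sum_(i <- s) F i x).
Proof.
move=> bF; elim: s => [|i s IH].
  rewrite (_ : (fun x => _) = (fun=> 0)); first exact: bm_cst.
  by apply/funext => x; rewrite big_nil.
rewrite (_ : (fun x => _) = (fun x => F i x + \sum_(j <- s) F j x)).
  exact: bmD.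
by apply/funext => x; rewrite big_cons.
Qed.

Lemma bm_eq f g : (forall x, I01 x -> f x = g x) -> bm f -> bm g.
Proof.
move=> fg [mf [M fM]]; split.
  by apply: eq_measurable_fun mf => x /set_mem Ix; exact: fg.
by exists M => x Ix; rewrite -fg ?fM.
Qed.

Lemma bm_integrable f : bm f -> mu.-integrable I01 (EFin \o f).
Proof.
move=> [mf [M fM]]; apply: measurable_bounded_integrable => //.
  by rewrite /= lebesgue_I01 ltry.
exists M; split; first exact: num_real.
by move=> N MN x Ix /=; rewrite (le_trans (fM _ Ix))// ltW.
Qed.

Lemma mean01E f : bm f -> (\int[mu]_(x in I01) (f x)%:E)%E = (mean01 f)%:E.
Proof.
move=> bf; rewrite /mean01 /Rintegral fineK//.
by apply: integrable_fin_num => //; exact: bm_integrable.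
Qed.

Lemma eq_mean01 f g : (forall x, I01 x -> f x = g x) -> mean01 f = mean01 g.
Proof. by move=> fg; apply: eq_Rintegral => x /set_mem; exact: fg. Qed.

Lemma mean01D f g : bm f -> bm g ->
  mean01 (fun x => f x + g x) = mean01 f + mean01 g.
Proof. by move=> bf bg; rewrite /mean01 RintegralD//; exact: bm_integrable. Qed.

Lemma mean01B f g : bm f -> bm g ->
  mean01 (fun x => f x - g x) = mean01 f - mean01 g.
Proof. by move=> bf bg; rewrite /mean01 RintegralB//; exact: bm_integrable. Qed.

Lemma mean01Z c f : bm f -> mean01 (fun x => c * f x) = c * mean01 f.
Proof. by move=> bf; rewrite /mean01 RintegralZl//; exact: bm_integrable. Qed.

Lemma mean01_cst c : mean01 (fun=> c) = c.
Proof. by rewrite /mean01 Rintegral_cst //= lebesgue_I01 /= mulr1. Qed.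

Lemma mean01_sum (I : Type) (s : seq I) (F : I -> R -> R) :
  (forall i, bm (F i)) ->
  mean01 (fun x => \sum_(i <- s) F i x) = \sum_(i <- s) mean01 (F i).
Proof.
move=> bF; elim: s => [|i s IH].
  rewrite big_nil -[RHS](mean01_cst 0); apply: eq_mean01 => x _.
  by rewrite big_nil.
rewrite big_cons -IH -mean01D//; last exact: bm_sum.
by apply: eq_mean01 => x _; rewrite big_cons.
Qed.

Lemma le_mean01 f g : bm f -> bm g -> (forall x, I01 x -> f x <= g x) ->
  mean01 f <= mean01 g.
Proof. by move=> bf bg fg; apply: le_Rintegral => //; exact: bm_integrable. Qed.

Lemma mean01_ge0 f : (forall x, I01 x -> 0 <= f x) -> 0 <= mean01 f.
Proof. by move=> f0; apply: Rintegral_ge0. Qed.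

(** Tonelli, applied to the kernel extended by zero outside the unit square, where nothing is known
    about [k]. *)
Lemma measurable_mean01_section (k : R * R -> R) :
  measurable_fun (I01 `*` I01) (k : _ -> measurableTypeR R) ->
  (forall x y, I01 x -> I01 y -> 0 <= k (x, y)) ->
  measurable_fun I01
    ((fun x => mean01 (fun y => k (x, y))) : measurableTypeR R -> measurableTypeR R).
Proof.
move=> mk k0.
pose K : measurableTypeR R * measurableTypeR R -> \bar R :=
  (EFin \o k) \_ (I01 `*` I01).
have mII : measurable (I01 `*` I01) by exact: measurableX.
have mK : measurable_fun setT K.
  by apply/(measurable_restrictT _ mII)/measurable_EFinP.
have K0 p : (0 <= K p)%E.
  rewrite /K /patch; case: ifPn => // /set_mem [p1 p2] /=.
  by rewrite lee_fin; case: p p1 p2 => x y /=; exact: k0.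
have := @measurable_fun_fubini_tonelli_F _ _ _ _ _ mu K mK K0.
move=> mF.
have {}mF : measurable_fun I01 (fine \o fubini_F mu K).
  apply: measurableT_comp => //.
  exact: measurable_funTS.
apply: eq_measurable_fun mF => x /set_mem Ix.
rewrite /= /fubini_F /mean01 /Rintegral; congr fine.
rewrite [RHS]integral_mkcond; apply: eq_integral => y _.
rewrite /K /patch; case: ifPn => [/set_mem[_ Iy]|nI].
  by rewrite mem_set.
rewrite memNset// => Iy; apply: (negP nI).
by rewrite inE.
Qed.

(** Dominated convergence with a constant bound; the exceptional set is null because it is
    countable. *)
Lemma mean01_cvg (f_ : nat -> R -> R) (f : R -> R) (E : set R) (M : R) :
  countable E -> (forall n, bm (f_ n)) -> bm f ->
  (forall n x, I01 x -> `|f_ n x| <= M) ->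
  (forall x, I01 x -> ~ E x -> f_ n x @[n --> \oo] --> f x) ->
  mean01 (f_ n) @[n --> \oo] --> mean01 f.
Proof.
move=> cE bf_ bf fM ff.
have [] := @dominated_convergence _ _ _ mu _ measurable_I01
  (fun n => EFin \o f_ n) (EFin \o f) (EFin \o cst M).
- by move=> n; apply/measurable_EFinP; case: (bf_ n).
- by apply/measurable_EFinP; case: bf.
- exists E; split; [exact: countable_measurable|exact: countable_lebesgue_measure0|].
  move=> x /= /not_implyP[Ix nf]; apply: contrapT => nE; apply: nf.
  by apply/cvg_EFin; [exact: nearW|exact: ff].
- exact: (bm_integrable (bm_cst M)).
- by apply: aeW => x n Ix; rewrite /= lee_fin fM.
move=> _ _ H; apply: fine_cvg.
by rewrite -mean01E.
Qed.

End bounded_measurable.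

(** * Densities of spiders as joint moments of the first and second degrees *)

Section tree_densities.
Context {R : realType}.

Local Notation mu := (@lebesgue_measure R).
Local Notation I01 := (`[0%R, 1%R]%classic : set (measurableTypeR R)).
Local Notation bm := bounded_measurable01.

Definition degree01 (W : R -> R -> R) (x : R) : R := mean01 (W x).

Definition degree2 (W : R -> R -> R) (x : R) : R :=
  mean01 (fun y => W x y * degree01 W y).

Section graphon.
Variable W : R -> R -> R.
Hypothesis graphonW : is_graphon W.

Lemma bm_graphon_section x : I01 x -> bm (W x).
Proof.
have [mW _ W01] := graphonW => Ix; split.
  have : measurable_fun I01 ((fun p => W p.1 p.2) \o pair x : R -> measurableTypeR R).
    apply: (measurable_comp (F := I01 `*` I01)) mW _.
    - exact: measurableX.
    - by move=> _ [y Iy <-].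
    - exact: measurable_funTS.
  by [].
by exists 1 => y Iy; have /andP[W0 W1] := W01 _ _ Ix Iy; rewrite ger0_norm.
Qed.

(** Serves both degrees: the kernels are [W x y] and [W x y * degree01 W y]. *)
Lemma bm_mean01_section (k : R * R -> R) :
  measurable_fun (I01 `*` I01) (k : _ -> measurableTypeR R) ->
  (forall x y, I01 x -> I01 y -> 0 <= k (x, y) <= 1) ->
  (forall x, I01 x -> bm (fun y => k (x, y))) ->
  bm (fun x => mean01 (fun y => k (x, y))) /\
  forall x, I01 x -> 0 <= mean01 (fun y => k (x, y)) <= 1.
Proof.
move=> mk k01 bk.
have m01 x : I01 x -> 0 <= mean01 (fun y => k (x, y)) <= 1.
  move=> Ix; apply/andP; split.
    by apply: mean01_ge0 => y Iy; case/andP: (k01 _ _ Ix Iy).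
  rewrite -(mean01_cst 1); apply: le_mean01 => [||y Iy].
  - exact: bk.
  - exact: bm_cst.
  - by case/andP: (k01 _ _ Ix Iy).
split=> //; split.
  apply: measurable_mean01_section => // x y Ix Iy.
  by case/andP: (k01 _ _ Ix Iy).
by exists 1 => x Ix; have /andP[m0 m1] := m01 x Ix; rewrite ger0_norm.
Qed.

Lemma bm_degree01 : bm (degree01 W) /\ forall x, I01 x -> 0 <= degree01 W x <= 1.
Proof.
have [mW _ W01] := graphonW.
exact: (bm_mean01_section mW W01 bm_graphon_section).
Qed.

Lemma bm_graphon_degree x : I01 x -> bm (fun y => W x y * degree01 W y).
Proof.
by move=> Ix; apply: bmM; [exact: bm_graphon_section|case: bm_degree01].
Qed.

Lemma bm_degree2 : bm (degree2 W).
Proof.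
have [mW _ W01] := graphonW; have [[md _] d01] := bm_degree01.
have [] // := @bm_mean01_section (fun p => W p.1 p.2 * degree01 W p.2).
- apply: measurable_funM => //.
  apply: (measurable_comp (F := I01)) md _ => //.
    by move=> _ [[x y] [_ Iy] <-].
  by apply: measurable_funTS; exact: measurable_snd.
- move=> x y Ix Iy /=; have /andP[W0 W1] := W01 _ _ Ix Iy.
  have /andP[d0 d1] := d01 _ Iy.
  by rewrite mulr_ge0//= mulr_ile1.
- exact: bm_graphon_degree.
Qed.

End graphon.

Lemma eq_integral01 n (f g : n.-tuple R -> \bar R) :
  (forall t : n.-tuple R, (forall u, u \in tval t -> I01 u) -> f t = g t) ->
  integral01 f = integral01 g.
Proof.
elim: n f g => [|n IH] f g fg /=; first by apply: fg.
apply: eq_integral => x /set_mem Ix; apply: IH => t It; apply: fg => u.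
by rewrite inE => /predU1P[-> //|/It].
Qed.

(** Integrand of a spider rooted at [x]: the first [2a] entries of [s] are read in pairs (middle,
    end) of legs, the others are leaves. The default [1] is not reached when [s] has at least [2a]
    entries. *)
Fixpoint spider (W : R -> R -> R) (x : R) (a : nat) (s : seq R) : R :=
  match a, s with
  | 0%N, _ => \prod_(u <- s) W x u
  | a'.+1, y :: z :: s' => W x y * W y z * spider W x a' s'
  | _, _ => 1
  end.

(** Once the root is fixed, the legs and leaves integrate independently, each leg giving [degree2]
    and each leaf [degree01]. The constant [c] absorbs the factors of variables already bound
    outside, which the induction needs. *)
Lemma integral01_spider (W : R -> R -> R) (a b : nat) (c x : R) :
  is_graphon W -> I01 x ->
  @integral01 R (a.*2 + b) (fun t => (c * spider W x a t)%:E) =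
  (c * (degree2 W x ^+ a * degree01 W x ^+ b))%:E.
Proof.
move=> gW Ix; elim: a c => [|a IH] c.
  rewrite expr0 mul1r [(0.*2 + b)%N]/=; elim: b c => [|b IH] c.
    by rewrite /= big_nil expr0.
  rewrite [LHS]/=.
  under eq_integral => y _.
    rewrite (@eq_integral01 _ _ (fun t => (c * W x y * spider W x 0 t)%:E)).
    rewrite IH. over.
    by move=> t _; rewrite /= big_cons mulrA.
  rewrite /= mean01E; last first.
    apply: bmM; last exact: bm_cst.
    by apply: bmM; [exact: bm_cst|exact: bm_graphon_section].
  congr EFin.
  rewrite (@eq_mean01 _ _ (fun y => (c * degree01 W x ^+ b) * W x y)); last first.
    by move=> y _; ring.
  by rewrite mean01Z ?exprS -/(degree01 W x); [ring|exact: bm_graphon_section].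
rewrite [LHS]/= -/double_rec -/(double a).
pose K := degree2 W x ^+ a * degree01 W x ^+ b.
transitivity (\int[mu]_(y in I01) (c * K * (W x y * degree01 W y))%:E)%E.
  apply: eq_integral => y /set_mem Iy.
  (* The end [z] of the leg is integrated first and turns [W y z] into the degree of the middle
     vertex [y]. *)
  transitivity (\int[mu]_(z in I01) (c * K * W x y * W y z)%:E)%E.
    apply: eq_integral => z _; rewrite (@eq_integral01 _ _
      (fun t => (c * W x y * W y z * spider W x a t)%:E)); last first.
      by move=> t _; rewrite /= !mulrA.
    by rewrite IH -/K; congr EFin; ring.
  rewrite mean01E; last by apply: bmM; [exact: bm_cst|exact: bm_graphon_section].
  rewrite mean01Z; last exact: bm_graphon_section.
  by rewrite -/(degree01 W y) mulrA.
rewrite mean01E; last by apply: bmM; [exact: bm_cst|exact: bm_graphon_degree].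
rewrite mean01Z; last exact: bm_graphon_degree.
by rewrite -/(degree2 W x) /K exprS; congr EFin; ring.
Qed.

(* Vertex [0] is the root, [2i+1, 2i+2] for [i < a] form the pendant paths of
   length two, and the remaining vertices are leaves at the root. *)
Definition spider_parent (a j : nat) : nat :=
  if (j <= a.*2)%N && ~~ odd j then j.-1 else 0%N.

Definition spider_edge (a b : nat) : rel 'I_(a.*2 + b).+1 := fun i j =>
  ((i < j) && (spider_parent a j == i) || (j < i) && (spider_parent a i == j))%N.

Lemma spider_edge_sym a b : symmetric (@spider_edge a b).
Proof. by move=> i j; rewrite /spider_edge orbC. Qed.

Lemma spider_edge_irr a b : irreflexive (@spider_edge a b).
Proof. by move=> i; rewrite /spider_edge ltnn. Qed.

(** Induction on the number of legs: removing the first leg shifts all later indices by two and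
    keeps the root at index 0. *)
Lemma spiderE (W : R -> R -> R) x a b (s : seq R) : size s = (a.*2 + b)%N ->
  \prod_(1 <= j < (a.*2 + b).+1) W (nth 0 (x :: s) (spider_parent a j)) (nth 0 (x :: s) j)
  = spider W x a s.
Proof.
elim: a s => [|a IH] s /=.
  rewrite double0 add0n => <-; rewrite big_add1 /= [RHS](big_nth 0).
  apply: eq_big_nat => j _.
  by [].
case: s => [//|y [//|z s]] /= [ss].
rewrite big_nat_recl// big_add1 big_nat_recl//= mulrA; congr (_ * _).
rewrite -(IH _ ss) big_add1 /=; apply: eq_big_nat => j jb.
rewrite /spider_parent /= negbK !ltnS.
change (W [:: x, y, z & s]`_(if (j < a.*2)%N && ~~ ~~ odd j then j.+2 else 0%N) s`_j =
  W (x :: s)`_(if (j < a.*2)%N && ~~ ~~ odd j then j else 0%N) s`_j).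
(* For [j = 0] parity selects the root on both sides; a positive index points past [y] and [z],
   where the lists agree up to the shift. *)
by case: j {jb} => [|j]; [rewrite andbF|case: ifP].
Qed.

Lemma spider_parent_lt a j : (0 < j)%N -> (spider_parent a j < j)%N.
Proof. by rewrite /spider_parent; case: j => // j _; case: ifP. Qed.

(** Each vertex other than the root has exactly one smaller neighbour, its parent, so edges can be
    indexed by their larger endpoint. *)
Lemma prod_spider_edge (W : R -> R -> R) a b (s : seq R) :
  \prod_(p : 'I_(a.*2 + b).+1 * 'I_(a.*2 + b).+1 |
      (p.1 < p.2)%N && spider_edge p.1 p.2) W (nth 0 s p.1) (nth 0 s p.2) =
  \prod_(1 <= j < (a.*2 + b).+1) W (nth 0 s (spider_parent a j)) (nth 0 s j).
Proof.
set n := (a.*2 + b)%N.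
rewrite -(pair_big_dep predT (fun i j : 'I_n.+1 => (i < j)%N && spider_edge i j)
  (fun i j => W (nth 0 s i) (nth 0 s j))) /=.
rewrite (exchange_big_dep predT) //= big_ord_recl big1 ?mul1r//.
rewrite big_add1 /= big_mkord; apply: eq_bigr => j _.
have pj : (spider_parent a (lift ord0 j) < n.+1)%N.
  by rewrite (ltn_trans (spider_parent_lt _ _)).
rewrite (big_pred1 (Ordinal pj)) // => i /=.
rewrite /spider_edge /eq_op /=; case: ltnP => /= ij.
  by rewrite ltnNge (ltnW ij) /= orbF eq_sym.
apply/esym/negbTE; apply: contraTneq ij => ->.
by rewrite -ltnNge spider_parent_lt.
Qed.

Lemma hom_density_spider (W : R -> R -> R) a b : is_graphon W ->
  hom_density (@spider_edge a b) W =
  (mean01 (fun x => degree2 W x ^+ a * degree01 W x ^+ b))%:E.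
Proof.
move=> gW; rewrite /hom_density.
rewrite (@eq_integral01 _ _ (fun t => (spider W (thead t) a (behead t))%:E)); last first.
  case/tupleP => x t _; rewrite theadE /=; congr EFin.
  rewrite -(@spiderE W x a b t) ?size_tuple// -prod_spider_edge.
  by apply: eq_bigr => p _; rewrite !(tnth_nth 0).
rewrite /=.
transitivity (\int[mu]_(x in I01) (degree2 W x ^+ a * degree01 W x ^+ b)%:E)%E; last first.
  rewrite mean01E//; apply: bmM; apply: bmX; first exact: bm_degree2.
  by case: (bm_degree01 gW).
apply: eq_integral => x /set_mem Ix; rewrite -(mul1r (_ * _)) -integral01_spider//.
apply: eq_integral01 => t _.
by rewrite mul1r theadE.
Qed.
End tree_densities.

(** * Polynomial approximation and functions with equal moments *)

Section moments.
Context {R : realType}.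

Local Notation mu := (@lebesgue_measure R).
Local Notation I01 := (`[0%R, 1%R]%classic : set (measurableTypeR R)).
Local Notation bm := bounded_measurable01.
Hint Resolve measurable_I01 : core.

Lemma bernoulli_le (a : R) n : 0 <= a <= 1 -> 1 - n%:R * a <= (1 - a) ^+ n.
Proof.
move=> a01; elim: n => [|n IH]; first by rewrite mul0r subr0.
have n0 : 0 <= n%:R :> R by [].
rewrite exprS -natr1; apply: (@le_trans _ _ ((1 - a) * (1 - n%:R * a))); nra.
Qed.

(** The left side is nonincreasing in [n], since [(1 - a) * (1 + (n + 1) * a) <= 1 + n * a]. *)
Lemma bernoulli_inv_le (a : R) n : 0 <= a <= 1 -> (1 - a) ^+ n * (1 + n%:R * a) <= 1.
Proof.
move=> a01; elim: n => [|n IH]; first by rewrite mul0r addr0 mulr1.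
have n0 : 0 <= n%:R :> R by [].
have p0 : 0 <= (1 - a) ^+ n by rewrite exprn_ge0//; lra.
rewrite exprS -natr1; apply: le_trans IH.
rewrite [X in X * _]mulrC -mulrA ler_wpM2l//; nra.
Qed.

(* Brosowski-Deutsch polynomials: they approximate the indicator function of
   [[0, 1/2[] boundedly on [[0, 1]]. *)
Lemma threshold_cvg1 (s : R) : 0 <= s < 2^-1 ->
  (1 - s ^+ n) ^+ (2 ^ n) @[n --> \oo] --> (1 : R).
Proof.
move=> /andP[s0 s2].
have sn n : 0 <= s ^+ n <= 1 by rewrite exprn_ge0// exprn_ile1//; lra.
apply: (@squeeze_cvgr _ _ _ _ (fun n => 1 - (2 * s) ^+ n) (fun=> 1)).
- near=> n; apply/andP; split.
    (* Bernoulli with exponent [2 ^ n]: the error [2 ^ n * s ^ n = (2 * s) ^ n] is geometric with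
       ratio below 1. *)
    by rewrite exprMn -natrX; exact: bernoulli_le.
  by have := sn n => /andP[? ?]; rewrite exprn_ile1//; lra.
- rewrite -[X in _ --> X]subr0; apply: cvgB; first exact: cvg_cst.
  by apply: cvg_expr; rewrite ger0_norm; lra.
- exact: cvg_cst.
Unshelve. all: by end_near. Qed.

Lemma threshold_cvg0 (s : R) : 2^-1 < s <= 1 ->
  (1 - s ^+ n) ^+ (2 ^ n) @[n --> \oo] --> (0 : R).
Proof.
move=> /andP[s0 s2].
have sn n : 0 <= s ^+ n <= 1 by rewrite exprn_ge0 ?exprn_ile1//; lra.
apply: (@squeeze_cvgr _ _ _ _ (fun=> 0) (fun n => (2 * s)^-1 ^+ n)).
- near=> n; have /andP[? ?] := sn n; apply/andP; split.
    by rewrite exprn_ge0//; lra.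
  (* This bounds the power by [1 / (1 + (2 * s) ^ n)], and now [2 * s > 1]. *)
  have := bernoulli_inv_le (2 ^ n) (sn n).
  rewrite natrX -exprMn => H; rewrite exprVn -div1r ler_pdivlMr; last first.
    by rewrite exprn_gt0//; lra.
  apply: le_trans H; rewrite ler_wpM2l//; last by lra.
  by rewrite exprn_ge0//; lra.
- exact: cvg_cst.
- apply: cvg_expr; rewrite ger0_norm ?invr_ge0; last by lra.
  by rewrite invf_lt1; lra.
Unshelve. all: by end_near. Qed.

Lemma bm_horner (q : {poly R}) f : bm f -> bm (fun x => q.[f x]).
Proof.
move=> bf; apply: (@bm_eq _ (fun x => \sum_(i < size q) q`_i * f x ^+ i)).
  by move=> x _; rewrite horner_coef.
by apply: bm_sum => i; apply: bmM; [exact: bm_cst|exact: bmX].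
Qed.

Lemma bm_indic (A : set R) : measurable A -> bm (\1_A : R -> R).
Proof.
move=> mA; split; first exact: measurable_indic.
by exists 1 => x _; rewrite indicE; case: (_ \in _); rewrite ?normr1 ?normr0.
Qed.

Lemma mean01_indic_itv (x y : R) : 0 <= x -> x <= y -> y <= 1 ->
  mean01 (\1_(`[x, y]) : R -> R) = y - x.
Proof.
move=> x0 xy y1; rewrite /mean01 /Rintegral integral_indic//.
rewrite setIidl; last first.
  by move=> z /=; rewrite !in_itv /=; lra.
have E : mu `[x, y]%classic = (y - x)%:E.
  by rewrite lebesgue_measure_itv /= lte_fin -EFinB; case: ltgtP xy => // -> _; rewrite subrr.
exact: (congr1 fine E).
Qed.

(** * An increasing [D1] with the moments of a [D] whose level sets are countable *)

Section monotone.
Variables D D1 h : R -> R.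
Hypothesis bD : bm D.
Hypothesis bD1 : bm D1.
Hypothesis bh : bm h.
Hypothesis D01 : forall x, I01 x -> 0 <= D x <= 1.
Hypothesis D101 : forall x, I01 x -> 0 <= D1 x <= 1.
Hypothesis monoD1 : forall x y, I01 x -> I01 y -> x <= y -> D1 x <= D1 y.
Hypothesis moments : forall q : {poly R},
  mean01 (fun x => q.[D1 x]) = mean01 (fun x => q.[D x]).
Hypothesis levels : forall c, countable [set x | I01 x /\ D x = c].
Hypothesis orth : forall q : {poly R}, mean01 (fun x => h x * q.[D1 x]) = 0.

(** Otherwise [D1] equals some [c] on [[x, y]]. Polynomials peaking at [c] then have mean at least
    [y - x] along [D1], while along [D] their means tend to 0 because the level set of [c] is
    null. *)
Lemma equimoment_strict x y : I01 x -> I01 y -> x < y -> D1 x < D1 y.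
Proof.
move=> Ix Iy xy; have := monoD1 Ix Iy (ltW xy); rewrite le_eqVlt => /orP[/eqP E|//].
exfalso.
have /andP[c0 c1] := D101 Ix.
move: (Ix) (Iy); rewrite /= !in_itv /= => /andP[x0 x1] /andP[y0 y1].
set c := D1 x in E c0 c1.
(* Equal to 1 at [c], tending to 0 at every other point of [[0, 1]]. *)
pose b n : {poly R} := (1 - ('X - c%:P) ^+ 2) ^+ n.
have bE n u : (b n).[u] = (1 - (u - c) ^+ 2) ^+ n.
  by rewrite /b !hornerE.
have b01 u : 0 <= u <= 1 -> 0 <= 1 - (u - c) ^+ 2 <= 1.
  move=> u01; have q0 := sqr_ge0 (u - c).
  have : 0 <= (1 - (u - c)) * (1 + (u - c)) by rewrite mulr_ge0//; lra.
  by rewrite -subr_sqr expr1n; lra.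
have : mean01 (fun x => (b n).[D x]) @[n --> \oo] --> mean01 (fun=> 0 : R).
  apply: (mean01_cvg (M := 1) (levels c)).
- by move=> n; exact: bm_horner.
- exact: bm_cst.
- move=> n z Iz; rewrite bE; have /andP[? ?] := b01 _ (D01 Iz).
  by rewrite ger0_norm ?exprn_ge0// exprn_ile1.
- move=> z Iz nE; under eq_fun do rewrite bE.
  apply: cvg_expr; have /andP[? ?] := b01 _ (D01 Iz).
  rewrite ger0_norm// ltrBlDr ltrDl exprn_even_gt0//= subr_eq0.
  by apply/eqP => Dz; apply: nE.
rewrite mean01_cst => H.
suff : y - x <= 0 by rewrite subr_le0 leNgt xy.
apply: (cvgr_to_ge H); near=> n.
rewrite -moments -(mean01_indic_itv x0 (ltW xy) y1); apply: le_mean01.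
- exact: bm_indic.
- exact: bm_horner.
- move=> z Iz; rewrite indicE; case: (boolP (z \in _)) => /= [|_].
    rewrite inE /= in_itv /= => /andP[xz zy].
    have -> : D1 z = c by apply: le_anti; rewrite {1}E !monoD1.
    by rewrite bE subrr expr0n subr0 expr1n.
  by rewrite bE; have /andP[? ?] := b01 _ (D101 Iz); rewrite exprn_ge0.
Unshelve. all: by end_near. Qed.

(** By strictness, comparing [D1 x] with [D1 s] is comparing [x] with [s], so threshold polynomials
    in [D1] converge boundedly to the indicator except possibly at [s]. *)
Lemma equimoment_orth_itv s : I01 s -> mean01 (fun x => h x * \1_(`[0, s]) x) = 0.
Proof.
move=> Is; pose t := D1 s.
have t01 := D101 Is; rewrite -/t in t01.
(* The affine map [u |-> (1 + u - t) / 2] sends [[0, 1]] into itself and [t] to the threshold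
   [1/2]. *)
pose q n : {poly R} := (1 - (2^-1 *: (1 + 'X - t%:P)) ^+ n) ^+ (2 ^ n).
have qE n u : (q n).[u] = (1 - ((1 + u - t) / 2) ^+ n) ^+ (2 ^ n).
  by rewrite /q !hornerE mulrC.
have [M hM] := bh.2.
have : mean01 (fun x => h x * (q n).[D1 x]) @[n --> \oo] -->
       mean01 (fun x => h x * \1_(`[0, s]) x).
  apply: (mean01_cvg (M := M) (countable1 s)).
- by move=> n; apply: bmM => //; exact: bm_horner.
- by apply: bmM => //; exact: bm_indic.
- move=> n x Ix; rewrite normrM qE -[M]mulr1 ler_pM// ?hM//.
  have := D101 Ix => u01.
  have /andP[? ?] : 0 <= ((1 + D1 x - t) / 2) ^+ n <= 1.
    by rewrite exprn_ge0 ?exprn_ile1//; lra.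
  by rewrite ger0_norm ?exprn_ge0 ?exprn_ile1//; lra.
- move=> x Ix /eqP xs; apply: cvgM; first exact: cvg_cst.
  under eq_fun do rewrite qE.
  have := D101 Ix => u01.
  move: xs; rewrite neq_lt indicE => /orP[xs|sx].
    rewrite mem_set; last first.
      by move: Ix; rewrite /= !in_itv /= (ltW xs) => /andP[->].
    apply: threshold_cvg1; have := equimoment_strict Ix Is xs.
    by rewrite -/t => ?; lra.
  rewrite memNset; last by rewrite /= in_itv /= (leNgt x s) sx andbF.
  apply: threshold_cvg0; have := equimoment_strict Is Ix sx.
  by rewrite -/t => ?; lra.
rewrite (_ : (fun n => _) = (fun=> 0)); last by apply/funext => n; exact: orth.
by move/(cvg_unique (@Rhausdorff R) (cvg_cst _)).
Qed.

(** All integrals of [h] over initial intervals vanish, so [h] is zero almost everywhere by Lebesgue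
    differentiation. *)
Lemma equimoment_orth : mean01 (fun x => h x ^+ 2) = 0.
Proof.
pose f := (h \_ I01) : R -> R.
have fT : mu.-integrable setT (EFin \o f).
  rewrite /f -restrict_EFin; apply/integrable_restrict => //=.
  by rewrite setTI; exact: bm_integrable.
have F0 x : \int[mu]_(t in [set` Interval (BLeft 0) (BRight x)]) f t = 0.
  have [x0|x0] := ltP x 0.
    rewrite set_itv_ge ?Rintegral_set0//.
    by rewrite bnd_simp -ltNge.
  (* Beyond 1 the primitive of [f] no longer changes, so the upper bound is capped. *)
  pose s := Num.min x 1.
  have Is : I01 s by rewrite /= in_itv /= le_min x0 ler01 ge_min lexx orbT.
  have fE (z : R) : (f \_ `[0, x]) z =
      ((fun u => h u * \1_(`[0, s]) u) \_ `[0, 1]) z.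
    rewrite /f /patch indicE !mem_setE !in_itv /= le_min.
    by case: (0 <= z); case: (z <= x); case: (z <= 1); rewrite /= ?mulr1 ?mulr0.
  rewrite -[RHS](equimoment_orth_itv Is) /mean01.
  rewrite Rintegral_mkcond [RHS]Rintegral_mkcond; congr Rintegral.
  apply/funext => z; exact: fE.
have f0 : {ae mu, forall x : R, 0 < x -> f x = 0}.
  have fI y : mu.-integrable [set` Interval (BLeft 0) (BRight y)] (EFin \o f).
    exact: integrableS fT.
  have := FTC1 fI (integrable_locally measurable_I01 (bm_integrable bh)); cbv zeta.
  under [X in derivable X]eq_fun do rewrite F0.
  under [X in derive1 X]eq_fun do rewrite F0.
  apply: filterS; first exact: (ae_filter_ringOfSetsType mu).
  move=> x H x0; have [|_ <-] := H; first by rewrite /= lte_fin.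
  by rewrite derive1_cst.
rewrite -(mean01_cst 0) /mean01 /Rintegral; congr fine.
apply: ae_eq_integral => //.
- by apply/measurable_EFinP; case: (bmX 2 bh).
(* Differentiation gave information only at [x > 0]; the endpoint 0 is discarded as a null set. *)
- have n0 : {ae mu, forall x : R, x <> 0}.
    by exists [set 0]; split => // [|x /= /contrapT]; rewrite ?lebesgue_measure_set1.
  move: f0 n0; apply: filterS2; first exact: (ae_filter_ringOfSetsType mu).
  move=> x H /eqP x0 Ix; congr EFin.
  have {}x0 : 0 < x.
    by move: (Ix); rewrite /= in_itv /= lt_neqAle eq_sym x0 => /andP[].
  by have := H x0; rewrite /f /patch mem_set// => ->; rewrite expr0n.
Qed.

End monotone.
End moments.

(** * The explicit graphon and its degrees *)

Section witness.
Context {R : realType}.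

Local Notation mu := (@lebesgue_measure R).
Local Notation I01 := (`[0%R, 1%R]%classic : set (measurableTypeR R)).
Local Notation bm := bounded_measurable01.

Lemma bm_id : bm (fun x : R => x).
Proof.
split; first exact: measurable_id.
by exists 1 => x; rewrite /= in_itv /= => /andP[x0 x1]; rewrite ger0_norm.
Qed.

Lemma mean01_horner_deriv (P : {poly R}) :
  mean01 (fun x => (P^`()).[x]) = P.[1] - P.[0].
Proof.
rewrite /mean01 /Rintegral (@continuous_FTC2 _ _ (horner P)) //.
- apply/continuous_subspaceT => x; exact: continuous_horner.
- split.
  + by move=> x _; exact: derivable_horner.
  + by apply: cvg_at_right_filter; exact: continuous_horner.
  + by apply: cvg_at_left_filter; exact: continuous_horner.
- by move=> x _; rewrite derivE.
Qed.

Lemma mean01_antisym (p : {poly R}) :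
  (forall x, p.[1 - x] = - p.[x]) -> mean01 (fun x => p.[x]) = 0.
Proof.
move=> antip; have bp : bm (fun x => p.[x]) by exact: (bm_horner p bm_id).
suff E : mean01 (fun x => p.[x]) = - mean01 (fun x => p.[x]) by lra.
rewrite -[in RHS]mulN1r -mean01Z// /mean01.
rewrite [LHS]Rintegration_by_substitution_onem ?lexx ?ler01//.
  rewrite /unstable.onem subrr; apply: eq_Rintegral => x _.
  by rewrite antip mulN1r.
apply/continuous_subspaceT => x; exact: continuous_horner.
Qed.

Definition tilt (x : R) : R := 2 * x - 1.
(** Up to the factor [2/3], the second Legendre polynomial in [tilt x]; [1/3] is the mean of
    [tilt ^ 2], so [bowl] has mean zero. *)
Definition bowl (x : R) : R := tilt x ^+ 2 - 3^-1.
(** The mixed terms integrate to zero in the degree, but [tilt x * bowl y] survives in the second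
    degree, where it meets the [bowl y] of the degree. Dividing by 8 keeps the values in
    [[0, 1]]. *)
Definition tilted_graphon (x y : R) : R :=
  2^-1 + (bowl x + bowl y + tilt x * bowl y + tilt y * bowl x) / 8.

Definition bowl_poly : {poly R} := (2 *: 'X - 1) ^+ 2 - (3^-1)%:P.

Lemma bowlE x : bowl x = bowl_poly.[x].
Proof. by rewrite /bowl_poly !hornerE. Qed.

Lemma bm_tilt : bm tilt.
Proof.
by apply: bmB; [apply: bmM; [exact: bm_cst|exact: bm_id]|exact: bm_cst].
Qed.

Lemma bm_bowl : bm bowl.
Proof. by apply: bmB; [apply: bmX; exact: bm_tilt|exact: bm_cst]. Qed.

(* The reflection [x |-> 1 - x] fixes [bowl] and changes the sign of [tilt]. *)
Lemma tilt_bowl_orth (q : {poly R}) : mean01 (fun x => tilt x * q.[bowl x]) = 0.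
Proof.
rewrite -(@mean01_antisym ((2 *: 'X - 1) * (q \Po bowl_poly))); last first.
  move=> x; rewrite !hornerM !horner_comp -!bowlE !hornerE /bowl /tilt.
  have -> : (2 * (1 - x) - 1) ^+ 2 = (2 * x - 1) ^+ 2 by ring.
  ring.
by apply: eq_mean01 => x _; rewrite hornerM horner_comp -bowlE !hornerE.
Qed.

Lemma mean01_bowl : mean01 bowl = 0.
Proof.
pose P : {poly R} := (4 / 3) *: 'X^3 - 2 *: 'X^2 + (2 / 3) *: 'X.
rewrite (@eq_mean01 _ _ (fun x => (P^`()).[x])); last first.
  by move=> x _; rewrite /P !poly.derivE !hornerE /bowl /tilt; field.
by rewrite mean01_horner_deriv /P !hornerE /=; field.
Qed.

Lemma mean01_bowl2 : mean01 (fun x => bowl x ^+ 2) = 4 / 45.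
Proof.
(* An antiderivative of [bowl ^ 2 = (4 x^2 - 4 x + 2/3)^2]. *)
pose P : {poly R} := (16 / 5) *: 'X^5 - 8 *: 'X^4 + (64 / 9) *: 'X^3
  - (8 / 3) *: 'X^2 + (4 / 9) *: 'X.
rewrite (@eq_mean01 _ _ (fun x => (P^`()).[x])); last first.
  by move=> x _; rewrite /P !poly.derivE !hornerE /= /bowl /tilt; field.
by rewrite mean01_horner_deriv /P !hornerE /=; field.
Qed.

(** For fixed [x], both [W x y] and [W x y * D y] are combinations of these five functions of [y];
    only [1] and [bowl ^ 2] have nonzero mean. *)
Lemma mean01_tilt_bowl a b c d e :
  mean01 (fun y => a + b * bowl y + c * tilt y + d * bowl y ^+ 2
                   + e * (tilt y * bowl y)) = a + d * (4 / 45).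
Proof.
have bt := bm_tilt; have bb := bm_bowl.
have b2 : bm (fun x => bowl x ^+ 2) by exact: bmX.
have bc z f : bm f -> bm (fun x => z * f x) by move=> bf; apply: bmM => //; exact: bm_cst.
have btb : bm (fun x => tilt x * bowl x) by exact: bmM.
have := bm_cst a => ba.
rewrite !mean01D ?mean01Z ?mean01_cst ?mean01_bowl ?mean01_bowl2//; do ?[apply: bmD|exact: bc|done].
have -> : mean01 tilt = 0.
  rewrite -(tilt_bowl_orth 1); apply: eq_mean01 => x _.
  by rewrite hornerC mulr1.
have -> : mean01 (fun x => tilt x * bowl x) = 0.
  rewrite -(tilt_bowl_orth 'X); apply: eq_mean01 => x _.
  by rewrite hornerX.
by rewrite !mulr0 !addr0.
Qed.

Lemma tilted_graphonP : is_graphon tilted_graphon.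
Proof.
split.
- apply: measurable_funTS.
  have mt : measurable_fun setT (tilt : measurableTypeR R -> measurableTypeR R).
    by apply: measurable_funB => //; apply: measurable_funM.
  have mb : measurable_fun setT (bowl : measurableTypeR R -> measurableTypeR R).
    by apply: measurable_funB => //; apply: measurable_funX.
  have m1 f : measurable_fun setT (f : measurableTypeR R -> measurableTypeR R) ->
      measurable_fun setT (fun p : measurableTypeR R * measurableTypeR R => f p.1).
    by move=> mf; apply: measurableT_comp mf _; exact: measurable_fst.
  have m2 f : measurable_fun setT (f : measurableTypeR R -> measurableTypeR R) ->
      measurable_fun setT (fun p : measurableTypeR R * measurableTypeR R => f p.2).
    by move=> mf; apply: measurableT_comp mf _; exact: measurable_snd.
  apply: measurable_funD => //; apply: measurable_funM => //.
  apply: measurable_funD; [apply: measurable_funD; [apply: measurable_funD|]|].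
  - exact: m1.
  - exact: m2.
  - by apply: measurable_funM; [exact: m1|exact: m2].
  - by apply: measurable_funM; [exact: m2|exact: m1].
- by move=> x y _ _; rewrite /tilted_graphon; ring.
- move=> x y; rewrite /= !in_itv /= => Ix Iy.
  have tb z : 0 <= z <= 1 -> (-1 <= tilt z <= 1) /\ (- 3^-1 <= bowl z <= 2 / 3).
    rewrite /bowl /tilt => z01; split; first by lra.
    have := sqr_ge0 (2 * z - 1).
    have : 0 <= z * (1 - z) by rewrite mulr_ge0//; lra.
    rewrite !expr2; lra.
  have [tx bx] := tb _ Ix; have [ty b_y] := tb _ Iy.
  have bnd (u v : R) : -1 <= u <= 1 -> - 3^-1 <= v <= 2 / 3 ->
      - (2 / 3) <= u * v <= 2 / 3.
    by move=> u1 v1; apply/andP; split; nra.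
  have := bnd _ _ tx b_y; have := bnd _ _ ty bx.
  by rewrite /tilted_graphon; lra.
Qed.

Lemma degree_tilted_graphon x : degree01 tilted_graphon x = 2^-1 + bowl x / 8.
Proof.
rewrite -[RHS]addr0 -[X in _ + X](mul0r (4 / 45)).
rewrite -(mean01_tilt_bowl _ ((1 + tilt x) / 8) (bowl x / 8) _ 0).
by apply: eq_mean01 => y _; rewrite /tilted_graphon; field.
Qed.

(** The coefficient of [bowl y ^ 2] in the integrand is [(1 + tilt x) / 64], and
    [4 / 45 / 64 = 1 / 720]. *)
Lemma degree2_tilted_graphon x : degree2 tilted_graphon x =
  degree01 tilted_graphon x / 2 + (1 + tilt x) / 720.
Proof.
transitivity ((2^-1 + bowl x / 8) / 2 + (1 + tilt x) / 64 * (4 / 45)); last first.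
  by rewrite degree_tilted_graphon; field.
rewrite -(mean01_tilt_bowl _ ((1 + tilt x) / 16 + (2^-1 + bowl x / 8) / 8)
  (bowl x / 16) _ (bowl x / 64)).
by apply: eq_mean01 => y _; rewrite degree_tilted_graphon /tilted_graphon; field.
Qed.

(** The degree is quadratic and symmetric about [1/2], so a level set through [x0] lies in
    [{x0, 1 - x0}]. *)
Lemma countable_degree_level (c : R) :
  countable [set x | I01 x /\ degree01 tilted_graphon x = c].
Proof.
have [->|/set0P[x0 [_ x0c]]] :=
  eqVneq [set x | I01 x /\ degree01 tilted_graphon x = c] set0.
  exact: countable0.
apply/finite_set_countable/(sub_finite_set _ (finite_set2 x0 (1 - x0))) => x [_]; rewrite -x0c !degree_tilted_graphon => E.
have : (x - x0) * (x - (1 - x0)) = 0.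
  by move: E; rewrite /bowl /tilt !expr2; lra.
move/eqP; rewrite mulf_eq0 !subr_eq0 => /orP[] /eqP ->; [by left|by right].
Qed.

Definition degree_dev_poly : {poly R} := 2^-1 *: 'X + (720^-1)%:P.

(** The polynomial is tailored to the witness but applied to every graphon, so that moments of the
    deviation transfer under equivalence. *)
Definition degree_dev (V : R -> R -> R) (x : R) : R :=
  degree2 V x - degree_dev_poly.[degree01 V x].

Lemma bm_degree_dev V : is_graphon V -> bm (degree_dev V).
Proof.
move=> gV; apply: bmB; first exact: bm_degree2.
by apply: bm_horner; case: (bm_degree01 gV).
Qed.

Lemma degree_dev_tilted_graphon x : degree_dev tilted_graphon x = tilt x / 720.
Proof.
by rewrite /degree_dev degree2_tilted_graphon /degree_dev_poly !hornerE /= /tilt; field.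
Qed.

(** * Transfer of moments between equivalent graphons *)

Section equivalent.
Variables V V' : R -> R -> R.
Hypotheses (gV : is_graphon V) (gV' : is_graphon V') (VV' : graphon_equiv V V').

(** Expanding [q] into monomials leaves spider densities, which equivalence preserves. *)
Lemma equiv_moments a (q : {poly R}) :
  mean01 (fun x => degree2 V x ^+ a * q.[degree01 V x]) =
  mean01 (fun x => degree2 V' x ^+ a * q.[degree01 V' x]).
Proof.
have expand U : is_graphon U -> mean01 (fun x => degree2 U x ^+ a * q.[degree01 U x]) =
    \sum_(i < size q) q`_i * mean01 (fun x => degree2 U x ^+ a * degree01 U x ^+ i).
  move=> gU; have b2 := bmX a (bm_degree2 gU); have [bd _] := bm_degree01 gU.
  have b2d i : bm (fun x => degree2 U x ^+ a * degree01 U x ^+ i).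
    by apply: bmM => //; exact: bmX.
  under [RHS]eq_bigr => i _ do rewrite -(mean01Z _ (b2d i)).
  rewrite -mean01_sum.
    apply: eq_mean01 => x _; rewrite horner_coef mulr_sumr.
    by apply: eq_bigr => i _; rewrite mulrCA.
  by move=> i; apply: bmM => //; exact: bm_cst.
rewrite !expand//; apply: eq_bigr => i _; congr (_ * _); apply: EFin_inj.
rewrite -!hom_density_spider//.
by apply: VV'; [exact: spider_edge_sym|exact: spider_edge_irr].
Qed.

Lemma equiv_degree_moments (q : {poly R}) :
  mean01 (fun x => q.[degree01 V x]) = mean01 (fun x => q.[degree01 V' x]).
Proof.
have E U : mean01 (fun x => q.[degree01 U x]) =
    mean01 (fun x => degree2 U x ^+ 0 * q.[degree01 U x]).
  by apply: eq_mean01 => x _; rewrite expr0 mul1r.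
by rewrite !E equiv_moments.
Qed.

Lemma equiv_degree_dev_moments (q : {poly R}) :
  mean01 (fun x => degree_dev V x * q.[degree01 V x]) =
  mean01 (fun x => degree_dev V' x * q.[degree01 V' x]).
Proof.
have E U : is_graphon U -> mean01 (fun x => degree_dev U x * q.[degree01 U x]) =
    mean01 (fun x => degree2 U x ^+ 1 * q.[degree01 U x]) -
    mean01 (fun x => (degree_dev_poly * q).[degree01 U x]).
  move=> gU; have [bd _] := bm_degree01 gU; rewrite -mean01B.
  - by apply: eq_mean01 => x _; rewrite /degree_dev hornerM mulrBl expr1.
  - by apply: bmM; [apply: bmX; exact: bm_degree2|exact: bm_horner].
  - exact: bm_horner.
by rewrite !E// equiv_moments equiv_degree_moments.
Qed.

(** The square expands into powers of [degree2] with coefficients polynomial in [degree01]. *)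
Lemma equiv_degree_dev_sqr :
  mean01 (fun x => degree_dev V x ^+ 2) = mean01 (fun x => degree_dev V' x ^+ 2).
Proof.
have E U : is_graphon U -> mean01 (fun x => degree_dev U x ^+ 2) =
    mean01 (fun x => degree2 U x ^+ 2 * (1 : {poly R}).[degree01 U x]) -
    mean01 (fun x => degree2 U x ^+ 1 * (2 *: degree_dev_poly).[degree01 U x]) +
    mean01 (fun x => (degree_dev_poly ^+ 2).[degree01 U x]).
  move=> gU; have [bd _] := bm_degree01 gU; have b2 := bm_degree2 gU.
  have bq a q : bm (fun x => degree2 U x ^+ a * q.[degree01 U x]).
    by apply: bmM; [exact: bmX|exact: bm_horner].
  rewrite -mean01B// -mean01D//; [|exact: bmB|exact: bm_horner].
  apply: eq_mean01 => x _; rewrite /degree_dev !hornerE /=.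
  by rewrite sqrrB; ring.
by rewrite !E// !equiv_moments equiv_degree_moments.
Qed.

End equivalent.
End witness.

(** * The contradiction from an increasing degree function *)

Theorem mainTheorem1 (R : realType) :
  exists W : R -> R -> R,
    is_graphon W /\
    ~ (exists W1 : R -> R -> R,
         [/\ is_graphon W1, graphon_equiv W W1 & increasing_degree W1]).
Proof.
exists tilted_graphon; split; first exact: tilted_graphonP.
move=> [W1 [gW1 eqW incW1]].
have gW := @tilted_graphonP R.
have [bD D01] := bm_degree01 gW; have [bD1 D101] := bm_degree01 gW1.
have := @equimoment_orth R (degree01 tilted_graphon) (degree01 W1) (degree_dev W1)
  bD bD1 (bm_degree_dev gW1) D01 D101.
rewrite -(equiv_degree_dev_sqr gW gW1 eqW) => H.
have {H} : mean01 (fun x : R => degree_dev tilted_graphon x ^+ 2) = 0.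
  apply: H.
  - move=> x y Ix Iy xy; rewrite -lee_fin.
    have dE z : `[0, 1]%classic z -> degree W1 z = (degree01 W1 z)%:E.
      by move=> Iz; rewrite /degree mean01E//; exact: bm_graphon_section.
    by rewrite -!dE//; exact: incW1.
  - by move=> q; rewrite -(equiv_degree_moments gW gW1 eqW).
  - exact: countable_degree_level.
  - move=> q; rewrite -(equiv_degree_dev_moments gW gW1 eqW).
    (* The witness has degree [p] evaluated at [bowl] and deviation [tilt / 720], so reflection
       symmetry gives the orthogonality. *)
    pose p : {poly R} := (2^-1)%:P + 8^-1 *: 'X.
    rewrite -(tilt_bowl_orth (720^-1 *: (q \Po p))).
    apply: eq_mean01 => x _.
    rewrite degree_dev_tilted_graphon degree_tilted_graphon hornerZ horner_comp.
    rewrite /p !hornerE /= (mulrC 8^-1); ring.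
(* Since [tilt ^ 2 = 1/3 + bowl], the second moment is [1 / (3 * 720 ^ 2)], which is not zero. *)
rewrite (@eq_mean01 _ _ (fun x => 3^-1 / 720 ^+ 2 + 720^-1 ^+ 2 * bowl x
  + 0 * tilt x + 0 * bowl x ^+ 2 + 0 * (tilt x * bowl x))).
  by rewrite mean01_tilt_bowl; lra.
by move=> x _; rewrite degree_dev_tilted_graphon /bowl; field.
Qed.
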